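(* Let $q>2$, $\sigma,B,K>0$, and let $X_1,\dots,X_n$ be independent mean-zero real-valued random variables with \[ \frac1n\sum_{i=1}^n\mathrm{Var}[X_i]\le\sigma^2,\qquad\frac1n\sum_{i=1}^n\mathbb{E}[|X_i|^q]\le B^q,\qquad\max_{1\le i\le n}|X_i|\le K\ \text{a.s.} \] Let $R=\big(1-(B^q/(\sigma^2K^{q-2}))^{1/(q-2)}\big)_+$. Then for every $z>1$, with probability at least $1-1/z$, \[ \frac1n\sum_{i=1}^nX_i<B\Big(\frac{\sigma^2}{B^2}\Big)^{\frac{q-1}{q-2}}\Psi^{-1}\Big(\Big(\frac{B^2}{\sigma^2}\Big)^{\frac q{q-2}}\frac{\ln z}n\Big)+\frac{2K\ln z}{nq}\Big(W\Big(\frac{(K/B)^{q/([q]+1)}(\ln z)^{1/([q]+1)}}{10\,(nR)^{1/([q]+1)}}\Big)\Big)^{-1}. \]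
   Context: $\Psi(x)=(1+x)\ln(1+x)-x$ for $x\ge0$, with inverse $\Psi^{-1}$ on $[0,\infty)$. $W$ is the Lambert function (principal branch, $W(x)e^{W(x)}=x$ for $x\ge0$), $[q]$ denotes the integer part of $q$, and $(x)_+=\max\{x,0\}$. When $R=0$ the argument of $W$ is interpreted as $+\infty$ and the second term on the right-hand side as $0$. *)

(* Defs.v *)
From HB Require Import structures.
From mathcomp Require Import all_boot all_order all_algebra.
From mathcomp Require Import all_classical all_reals all_analysis.
Set Implicit Arguments. Unset Strict Implicit. Unset Printing Implicit Defensive.
Import Order.TTheory GRing.Theory Num.Theory.
Import numFieldNormedType.Exports.
Local Open Scope classical_set_scope.
Local Open Scope ring_scope.

Definition Psi {R : realType} (x : R) : R := (1 + x) * ln (1 + x) - x.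

Definition Psi_inv {R : realType} (y : R) : R :=
  get [set x : R | 0 <= x /\ Psi x = y].

Definition LambertW {R : realType} (x : R) : R :=
  get [set w : R | 0 <= w /\ w * expR w = x].

Definition mutually_independent_RV {d} {T : measurableType d} {R : realType}
  (P : probability T R) (n : nat) (X : 'I_n -> T -> R) : Prop :=
  forall (J : {set 'I_n}) (A : 'I_n -> set R),
    (forall i, measurable (A i)) ->
    P (\big[setI/setT]_(i in J) (X i @^-1` A i)) =
    (\prod_(i in J) P (X i @^-1` A i))%E.

(* Main.v *)
(* Put rho = (B^q / sigma^2)^(1/(q-2)) and m = [q] + 1, so that R = (1 - rho/K)_+.
   Interpolating between the second and the q-th moment gives
   E|X|^k <= sigma^2 rho^(k-2) for k < m, while |X| <= K gives
   E|X|^k <= sigma^2 rho^(q-2) K^(k-q) for k >= m.  Hence the averaged log-Laplace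
   transform at l is at most G(l) + F(l), where
   G(l) = sigma^2/rho^2 (exp(l rho) - 1 - l rho) is Bennett's function and
   F(l) = (B/K)^q R (l K)^m exp(l K) / m! bounds the excess of the tail of the
   exponential series.  With x = ln z / n, Bennett's optimal l1 satisfies
   G(l1) + x = l1 t1 and l2 = q W / K satisfies F(l2) + x <= l2 t2, where t1 and t2
   are the two terms of the bound.  Since G(l)/l and F(l)/l are nondecreasing, the
   choice 1/l = 1/l1 + 1/l2 yields G(l) + F(l) + x <= l (t1 + t2), which is what
   Chernoff's bound requires. *)
Require Import Defs.
From HB Require Import structures.
From mathcomp Require Import all_boot all_order all_algebra.
From mathcomp Require Import all_classical all_reals all_analysis.
From mathcomp Require Import finmap measurable_realfun.
From mathcomp Require Import ring lra.
Import Order.TTheory GRing.Theory Num.Theory.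
Import numFieldNormedType.Exports.
Local Open Scope classical_set_scope.
Local Open Scope ring_scope.

(** * Tails of the exponential series and interpolation of powers *)

(** For [m = 2] this is exp(t) - 1 - t, the function of Bennett's inequality; the closed form makes
    that case available without a limit. *)
Definition expR_tail {R : realType} (m : nat) (t : R) : R :=
  expR t - \sum_(0 <= k < m) t ^+ k / k`!%:R.

Lemma cvg_expR_tail (R : realType) (m : nat) (t : R) :
  (fun N => \sum_(m <= k < N) t ^+ k / k`!%:R) @ \oo --> expR_tail m t.
Proof.
have cvg_exp : series (exp_coeff t) @ \oo --> expR t.
  exact: is_cvg_series_exp_coeff.
have : (fun N => series (exp_coeff t) N - \sum_(0 <= k < m) t ^+ k / k`!%:R)
    @ \oo --> expR_tail m t.
  by apply: cvgB => //; exact: cvg_cst.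
apply: cvg_trans; apply: near_eq_cvg.
near=> N.
have mN : (m <= N)%N by near: N; exact: nbhs_infty_ge.
by rewrite /= /series /= (big_cat_nat _ mN)//= addrAC subrr add0r.
Unshelve. all: by end_near. Qed.

(** Large inequalities pass to the limit, so comparisons between tails reduce to comparisons of
    finite sums, done term by term. *)
Lemma expR_tail_lecomb (R : realType) (m : nat) (a b c t u : R) :
  (forall N, a * \sum_(m <= k < N) t ^+ k / k`!%:R <=
             b * \sum_(m <= k < N) u ^+ k / k`!%:R + c) ->
  a * expR_tail m t <= b * expR_tail m u + c.
Proof.
move=> le_partial.
have cvg_l : (fun N => a * \sum_(m <= k < N) t ^+ k / k`!%:R) @ \oo -->
    a * expR_tail m t.
  by apply: cvgM; [exact: cvg_cst|exact: cvg_expR_tail].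
have cvg_r : (fun N => b * \sum_(m <= k < N) u ^+ k / k`!%:R + c) @ \oo -->
    b * expR_tail m u + c.
  apply: cvgD; last exact: cvg_cst.
  by apply: cvgM; [exact: cvg_cst|exact: cvg_expR_tail].
apply: (ler_cvg_to cvg_l cvg_r).
by near=> N; exact: le_partial.
Unshelve. all: by end_near. Qed.

Lemma expR_tail_ge0 (R : realType) (m : nat) (t : R) :
  0 <= t -> 0 <= expR_tail m t.
Proof.
move=> t0; have := @expR_tail_lecomb R m 0 1 0 0 t.
rewrite mul0r mul1r addr0; apply=> N; rewrite mul0r mul1r addr0.
by apply: sumr_ge0 => k _; rewrite divr_ge0// exprn_ge0.
Qed.

Lemma expR_tailE (R : realType) (m p : nat) (t : R) : (p <= m)%N ->
  expR_tail p t = \sum_(p <= k < m) t ^+ k / k`!%:R + expR_tail m t.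
Proof.
by move=> pm; rewrite /expR_tail (@big_cat_nat _ _ _ p 0%N m)//=; ring.
Qed.

(** Every term has degree [k >= m >= p], so it picks up the factor s^k <= s^p. It is used with [p]
    equal to [q], 2 and 1. *)
Lemma expR_tail_scale (R : realType) (m : nat) (p s t : R) :
  0 <= s <= 1 -> 0 < p -> p <= m%:R -> 0 <= t ->
  expR_tail m (s * t) <= s `^ p * expR_tail m t.
Proof.
move=> /andP[s0 s1] p0 pm t0.
have := @expR_tail_lecomb R m 1 (s `^ p) 0 (s * t) t.
rewrite mul1r addr0; apply => N; rewrite mul1r addr0 mulr_sumr.
apply: ler_sum_nat => k /andP[mk _].
rewrite exprMn mulrA ler_wpM2r ?invr_ge0// ler_wpM2r ?exprn_ge0//.
(* For [s = 0] the degree [k] must be nonzero: [0 < p <= m] forces [m > 0]. *)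
move: s0; rewrite le_eqVlt => /predU1P[<-|s0].
  by rewrite powR0 ?gt_eqF// expr0n; case: k mk => //; case: m pm => // pm;
    rewrite leNgt p0 in pm.
rewrite -powR_mulrn ?(ltW s0)// ger_powR ?s0//.
by rewrite (le_trans pm)// ler_nat.
Qed.

(** Only the terms of degree at least 2 are replaced by absolute values; the linear term keeps its
    sign, so that centring can cancel it. *)
Lemma expR_le_tail2 (R : realType) (y : R) :
  expR y <= 1 + y + expR_tail 2 `|y|.
Proof.
suff : expR_tail 2 y <= expR_tail 2 `|y|.
  by rewrite {1}/expR_tail !big_nat_recr//= big_geq//= !fact0 factS fact0;
    rewrite expr0 expr1 !divr1 add0r; lra.
have := @expR_tail_lecomb R 2 1 1 0 y `|y|.
rewrite !mul1r addr0; apply => N; rewrite !mul1r addr0.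
apply: ler_sum_nat => k _; rewrite ler_wpM2r ?invr_ge0//.
by rewrite -normrX ler_norm.
Qed.

(** Passing from [j] to [j + 1] multiplies the left side by j + 2 and the right side by m + j + 1,
    which is no smaller. In the form (j+1)/(m+j)! <= 1/(m! j!) it factors the coefficients of a
    tail. *)
Lemma fact_mul_le (m j : nat) : (0 < m)%N ->
  (m`! * (j.+1)`! <= (m + j)`!)%N.
Proof.
move=> m0; elim: j => [|j IH]; first by rewrite muln1 addn0.
rewrite factS mulnCA addnS [X in (_ <= X)%N]factS leq_mul//.
by rewrite ltnS -add1n leq_add2r.
Qed.

Lemma exp_partial_le (R : realType) (t : R) (N : nat) : 0 <= t ->
  \sum_(0 <= k < N) t ^+ k / k`!%:R <= expR t.
Proof.
move=> t0; have := @expR_tail_ge0 R N t t0.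
by rewrite /expR_tail subr_ge0.
Qed.

(** Bernoulli's inequality: 1 - r^(j+1) is (1 - r) times a geometric sum of j + 1 terms, each at
    most 1. *)
Lemma one_sub_powR_le (R : realType) (r e : R) (j : nat) : 0 < r <= 1 ->
  e <= j.+1%:R -> 1 - r `^ e <= (j.+1)%:R * (1 - r).
Proof.
move=> r01 ej; have /andP[r0 r1] := r01.
have : r ^+ j.+1 <= r `^ e by rewrite -powR_mulrn ?(ltW r0)// ger_powR.
suff : 1 - r ^+ j.+1 <= j.+1%:R * (1 - r) by lra.
rewrite -{1}(expr1n R j.+1) subrXX mulrC ler_wpM2r ?subr_ge0//.
rewrite (_ : j.+1%:R = \sum_(i < j.+1) (1:R)); last by rewrite sumr_const card_ord.
by apply: ler_sum => i _; rewrite expr1n mul1r exprn_ile1// ltW.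
Qed.

(** In degree m + j the two tails differ by the factor 1 - r^(m+j-q), at most (j + 1)(1 - r). The
    factor j + 1 is absorbed by the factorials, and the remaining sum over [j] is a partial sum of
    exp(u). The last term is the origin of the function F. *)
Lemma expR_tail_contract (R : realType) (m : nat) (q r u : R) :
  0 < r <= 1 -> (0 < m)%N -> m%:R <= q + 1 -> 0 <= u ->
  r `^ q * expR_tail m u <=
  expR_tail m (r * u) + r `^ q * ((1 - r) * (u ^+ m / m`!%:R * expR u)).
Proof.
move=> r01 m0 mq u0; have /andP[r0 r1] := r01.
rewrite -[expR_tail m (r * u)]mul1r.
apply: expR_tail_lecomb => N; rewrite mul1r.
(* Both sums are reindexed by [k = m + j], one rewrite for each. *)
have -> : forall f : nat -> R, \sum_(m <= k < N) f k = \sum_(0 <= j < N - m) f (m + j)%N.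
  by move=> f; rewrite -{1}[m]add0n big_addn; apply: eq_bigr => j _; rewrite addnC.
have -> : forall f : nat -> R, \sum_(m <= k < N) f k = \sum_(0 <= j < N - m) f (m + j)%N.
  by move=> f; rewrite -{1}[m]add0n big_addn; apply: eq_bigr => j _; rewrite addnC.
apply: le_trans (_ : \sum_(0 <= j < N - m) ((r * u) ^+ (m + j) / (m + j)`!%:R
   + r `^ q * ((1 - r) * (u ^+ m / m`!%:R * (u ^+ j / j`!%:R)))) <= _); last first.
  rewrite big_split/= lerD2l -!mulr_sumr ler_wpM2l ?powR_ge0//.
  rewrite ler_wpM2l ?subr_ge0// ler_wpM2l ?exp_partial_le//.
  by rewrite divr_ge0// exprn_ge0.
rewrite mulr_sumr; apply: ler_sum => j _.
(* The assumption [m <= q + 1] bounds the exponent m + j - q by j + 1. *)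
have H1 : 1 - r `^ ((m + j)%:R - q) <= j.+1%:R * (1 - r).
  by apply: one_sub_powR_le => //; rewrite natrD -addn1 natrD; lra.
have H2 : r `^ q * r `^ ((m + j)%:R - q) = r ^+ (m + j).
  by rewrite -powRD ?(gt_eqF r0) ?implybT// addrC subrK powR_mulrn// ltW.
have H3 : j.+1%:R / (m + j)`!%:R <= (m`!%:R)^-1 * (j`!%:R)^-1 :> R.
  rewrite ler_pdivrMr ?ltr0n ?fact_gt0// -invfM mulrC ler_pdivlMr; last first.
    by rewrite mulr_gt0// ltr0n fact_gt0.
  rewrite -!natrM ler_nat mulnC -mulnA [(_`! * j.+1)%N]mulnC -factS.
  exact: fact_mul_le.
rewrite exprMn -H2.
set v := u ^+ (m + j); have v0 : 0 <= v by rewrite exprn_ge0.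
set s := r `^ (_ - q) in H1 *.
have -> : u ^+ m / m`!%:R * (u ^+ j / j`!%:R) = v * ((m`!%:R)^-1 * (j`!%:R)^-1).
  by rewrite /v exprD; ring.
set C := _^-1 * _^-1 in H3 *.
rewrite -!mulrA -mulrDr ler_wpM2l ?powR_ge0//.
rewrite -lerBlDl.
have -> : v / (m + j)`!%:R - s * (v / (m + j)`!%:R) =
   (v / (m + j)`!%:R) * (1 - s) by ring.
apply: le_trans (_ : (v / (m + j)`!%:R) * (j.+1%:R * (1 - r)) <= _).
  by rewrite ler_wpM2l// divr_ge0.
have -> : v / (m + j)`!%:R * (j.+1%:R * (1 - r)) =
   (1 - r) * (v * (j.+1%:R / (m + j)`!%:R)) by ring.
by rewrite ler_wpM2l ?subr_ge0// ler_wpM2l.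
Qed.

(* Weighted AM-GM for [v] and [1]: both tangent-line bounds of [expR] are taken at
   [th * ln v] and averaged. *)
Lemma powR_interp (R : realType) (v th : R) : 0 < v -> 0 <= th <= 1 ->
  v `^ th <= (1 - th) + th * v.
Proof.
move=> v0 /andP[t0 t1].
have ve : v = expR (ln v) by rewrite lnK.
rewrite /powR gt_eqF//.
set L := ln v in ve *; rewrite ve.
have e0 := expR_gt0 (th * L).
have h1 := @expR_ge1Dx R ((1 - th) * L).
have h2 := @expR_ge1Dx R (- (th * L)).
have E1 : expR L = expR (th * L) * expR ((1 - th) * L).
  by rewrite -expRD; congr expR; ring.
have E2 : 1 = expR (th * L) * expR (- (th * L)) by rewrite -expRD subrr expR0.
have : expR (th * L) * (1 + (1 - th) * L) <= expR L.
  by rewrite E1 ler_wpM2l// ltW.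
have : expR (th * L) * (1 + - (th * L)) <= 1.
  by rewrite [leRHS]E2 ler_wpM2l// ltW.
move: (expR L) (expR (th * L)) => x y; nra.
Qed.

(** With th = (k-2)/(q-2), this is s^2 times the inequality s^(k-2) <= (1 - th) + th s^(q-2). The
    right side is linear in s^2 and s^q, hence integrates to the two controlled moments. *)
Lemma exprn_interp (R : realType) (q s : R) (k : nat) :
  2 < q -> (2 <= k)%N -> k%:R <= q -> 0 <= s ->
  s ^+ k <= (1 - (k%:R - 2) / (q - 2)) * s ^+ 2 + (k%:R - 2) / (q - 2) * s `^ q.
Proof.
move=> q2 k2 kq; rewrite le_eqVlt => /predU1P[<-|s0].
  by rewrite powR0 ?expr0n ?mulr0 ?addr0//; [case: k k2 kq|rewrite gt_eqF//; lra].
set th := _ / _.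
have q20 : 0 < q - 2 by lra.
have th0 : 0 <= th <= 1.
  rewrite /th divr_ge0 ?subr_ge0 ?ler_nat// ?(ltW q2)//= ler_pdivrMr// mul1r.
  by rewrite lerB.
have := @powR_interp R (s `^ (q - 2)) th (powR_gt0 _ s0) th0.
rewrite -powRrM mulrC {1}/th divfK ?gt_eqF// => H.
have -> : s ^+ k = s ^+ 2 * s `^ (k%:R - 2).
  by rewrite -!powR_mulrn ?(ltW s0)// -powRD ?(gt_eqF s0) ?implybT//; congr (_ `^ _); ring.
have -> : s `^ q = s ^+ 2 * s `^ (q - 2).
  by rewrite -!powR_mulrn ?(ltW s0)// -powRD ?(gt_eqF s0) ?implybT//; congr (_ `^ _); ring.
have -> : (1 - th) * s ^+ 2 + th * (s ^+ 2 * s `^ (q - 2)) =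
  s ^+ 2 * (1 - th + th * s `^ (q - 2)) by ring.
by rewrite ler_wpM2l// exprn_ge0// ltW.
Qed.

(** * Expectation of a product of functions of independent variables *)

Section independence.
Local Open Scope ereal_scope.
Import HBNNSimple.
Variables (d : measure_display) (T : measurableType d) (R : realType).
Variable P : probability T R.

Lemma cvg_integral_nondecreasing (g : nat -> T -> \bar R) (f : T -> \bar R) :
  (forall n, measurable_fun setT (g n)) -> (forall n w, 0 <= g n w) ->
  (forall w, {homo g ^~ w : a b / (a <= b)%N >-> a <= b}) ->
  (forall w, g n w @[n --> \oo] --> f w) ->
  \int[P]_w g n w @[n --> \oo] --> \int[P]_w f w.
Proof.
move=> mg g0 nd_g gf.
have -> : \int[P]_w f w = \int[P]_w limn (g ^~ w).
  by apply: eq_integral => w _; apply/esym/cvg_lim => //; exact: gf.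
by apply: cvg_monotone_convergence => //.
Qed.

(** Factorisation extends from indicators to simple functions by linearity and to nonnegative
    measurable functions by monotone convergence. *)
Lemma integral_mul_comp_cst (X Y : T -> R) (c : \bar R) :
  measurable_fun setT X -> measurable_fun setT Y ->
  (forall w, (0 <= Y w)%R) -> 0 <= c ->
  (forall A, measurable A ->
     \int[P]_w (Y w * \1_A (X w))%:E = c * \int[P]_w (\1_A (X w))%:E) ->
  forall f : R -> R, measurable_fun setT f -> (forall x, (0 <= f x)%R) ->
  \int[P]_w (Y w * f (X w))%:E = c * \int[P]_w (f (X w))%:E.
Proof.
move=> mX mY Y0 c0 H f mf f0.
have mEf : measurable_fun [set: R] (EFin \o f) by exact/measurable_EFinP.
pose h := nnsfun_approx measurableT mEf.
have cvg_h x : (h n x)%:E @[n --> \oo] --> (f x)%:E.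
  apply: (@cvg_nnsfun_approx _ _ _ _ measurableT _ mEf) => //= t _.
  by rewrite lee_fin.
have nd_h x : {homo (fun n => h n x) : a b / (a <= b)%N >-> (a <= b)%R}.
  by move=> a b ab; exact/lefP/nd_nnsfun_approx.
have m1 A : measurable A -> measurable_fun setT (fun w => \1_A (X w) : R).
  by move=> mA; exact: measurableT_comp.
have mh n : measurable_fun setT (fun w => h n (X w)).
  by apply: measurableT_comp => //; exact: measurable_funP.
have cvgl : \int[P]_w (Y w * h n (X w))%:E @[n --> \oo] -->
    \int[P]_w (Y w * f (X w))%:E.
  apply: cvg_integral_nondecreasing => [n|n w|w a b ab|w].
  - by apply/measurable_EFinP; exact: measurable_funM.
  - by rewrite lee_fin mulr_ge0.
  - by rewrite lee_fin ler_wpM2l// nd_h.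
  - by under eq_fun do rewrite EFinM; rewrite EFinM; exact: cvgeZl.
have cvgr : \int[P]_w (h n (X w))%:E @[n --> \oo] --> \int[P]_w (f (X w))%:E.
  apply: cvg_integral_nondecreasing => [n|n w|w a b ab|w].
  - exact/measurable_EFinP.
  - by rewrite lee_fin.
  - by rewrite lee_fin nd_h.
  - exact: cvg_h.
suff E n : \int[P]_w (Y w * h n (X w))%:E = c * \int[P]_w (h n (X w))%:E.
  have cE : \int[P]_w (Y w * h n (X w))%:E @[n --> \oo] -->
      c * \int[P]_w (f (X w))%:E.
    under eq_fun do rewrite E.
    (* Extended multiplication is not continuous where 0 meets infinity, so the cases [c = 0] and
       limit integral 0 are treated apart; in the latter the nondecreasing integrals are all 0. *)
    have [->|c_neq0] := eqVneq c 0.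
      by rewrite mul0e; under eq_fun do rewrite mul0e; exact: cvg_cst.
    have [I0|I_neq0] := eqVneq (\int[P]_w (f (X w))%:E) 0.
      rewrite I0 mule0; apply: cvg_near_cst; apply: nearW => n.
      have nd_int : {homo (fun m => \int[P]_w (h m (X w))%:E) :
          a b / (a <= b)%N >-> a <= b}.
        move=> a b ab; apply: ge0_le_integral => //.
        - by move=> w _; rewrite lee_fin.
        - exact/measurable_EFinP.
        - exact/measurable_EFinP.
        - by move=> w _; rewrite lee_fin nd_h.
      have sup0 := cvg_unique (@ereal_hausdorff R) (ereal_nondecreasing_cvgn nd_int) cvgr.
      have -> : \int[P]_w (h n (X w))%:E = 0; last by rewrite mule0.
      apply/eqP; rewrite eq_le integral_ge0 ?andbT; last first.
        by move=> w _; rewrite lee_fin.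
      have := sup0; rewrite I0 => <-.
      by apply: ereal_sup_ubound; exists n.
    have cI : c *? \int[P]_w (f (X w))%:E.
      by apply: neq0_mule_def; rewrite mule_eq0 negb_or c_neq0 I_neq0.
    exact: (cvgeM cI (cvg_cst c) cvgr).
  exact: (cvg_unique (@ereal_hausdorff R) cvgl cE).
(* It remains to treat a simple function: it is a finite combination of indicators of its level sets
   with nonnegative values, and [H] applies to each. *)
have h0 : forall i : 'I_#|`fset_set (range (h n))|, (0 <= (fset_set (range (h n)))`_i)%R.
  move=> i; have : (fset_set (range (h n)))`_i \in fset_set (range (h n)).
    by apply: mem_nth; exact: ltn_ord.
  by rewrite in_fset_set// => /set_mem[x _ <-].
pose F i w := ((fset_set (range (h n)))`_i * \1_(h n @^-1` [set (fset_set (range (h n)))`_i]) (X w))%R.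
have m2 (i : 'I_#|`fset_set (range (h n))|) : measurable_fun setT (F i).
  by apply: measurable_funM => //; apply: m1.
have F0 (i : 'I_#|`fset_set (range (h n))|) w : (0 <= F i w)%R by apply: mulr_ge0.
transitivity (\int[P]_w \sum_(i < #|`fset_set (range (h n))|) (Y w * F i w)%:E).
  by apply: eq_integral => w _; rewrite fimfunEord mulr_sumr sumEFin.
transitivity (c * \int[P]_w \sum_(i < #|`fset_set (range (h n))|) (F i w)%:E); last first.
  by congr (_ * _); apply: eq_integral => w _; rewrite fimfunEord sumEFin.
rewrite ge0_integral_sum//; last 2 first.
- by move=> i; apply/measurable_EFinP; exact: measurable_funM.
- by move=> i w _; rewrite lee_fin mulr_ge0.
rewrite ge0_integral_sum//; last 2 first.
- by move=> i; apply/measurable_EFinP.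
- by move=> i w _; rewrite lee_fin.
rewrite ge0_sume_distrr; last by move=> i _; apply: integral_ge0 => w _; rewrite lee_fin.
apply: eq_bigr => i _.
have := H (h n @^-1` [set (fset_set (range (h n)))`_i]) ltac:(by []) => HA.
under eq_integral do rewrite mulrCA EFinM.
rewrite ge0_integralZl_EFin//; last 2 first.
- by move=> w _; rewrite lee_fin mulr_ge0.
- by apply/measurable_EFinP; apply: measurable_funM => //; apply: m1.
rewrite HA muleCA -ge0_integralZl_EFin//.
by apply/measurable_EFinP; apply: m1.
Qed.

Lemma expectation_prod_indep (n : nat) (X : 'I_n -> T -> R)
    (f : 'I_n -> R -> R) :
  (forall i, measurable_fun setT (X i)) ->
  mutually_independent_RV P X ->
  (forall i, measurable_fun setT (f i)) -> (forall i x, (0 <= f i x)%R) ->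
  \int[P]_w (\prod_(i < n) f i (X i w))%:E =
  \prod_(i < n) \int[P]_w (f i (X i w))%:E.
Proof.
move=> mX indep mf f0.
(* Replace indicators by the [f i] one index at a time: below [k] the [g i] are
   arbitrary, from [k] on they are indicators. *)
suff H k (g : 'I_n -> R -> R) : (forall i, measurable_fun setT (g i)) ->
    (forall i x, (0 <= g i x)%R) ->
    (forall i : 'I_n, (k <= i)%N -> exists2 A, measurable A & g i = \1_A) ->
    \int[P]_w (\prod_(i < n) g i (X i w))%:E =
    \prod_(i < n) \int[P]_w (g i (X i w))%:E.
  by apply: (H n) => // i; rewrite leqNgt ltn_ord.
elim: k g => [|k IH] g mg g0 g1.
  (* All factors are indicators here; their product is the indicator of the intersection, and
     independence is used with the full index set. *)
  have /choice[A AP] : forall i : 'I_n, exists A, measurable A /\ g i = \1_A.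
    by move=> i; have [A ? ?] := g1 i (leq0n i); exists A.
  have mA i : measurable (A i) by have [] := AP i.
  have gA i : g i = \1_(A i) by have [] := AP i.
  have mXA i : measurable (X i @^-1` A i) by rewrite -[X in measurable X]setTI; exact: mX.
  have := indep [set: 'I_n]%SET A mA.
  rewrite (eq_bigl xpredT) => [|i]; last by rewrite inE.
  rewrite [in RHS](eq_bigl xpredT) => [indepA|i]; last by rewrite inE.
  transitivity (\int[P]_w (\1_(\big[setI/setT]_(i < n) (X i @^-1` A i)) w)%:E).
    apply: eq_integral => w _; congr EFin.
    rewrite (big_morph (fun B : set T => \1_B w : R) (id1 := 1%R) (op1 := *%R)).
    - by apply: eq_bigr => i _; rewrite gA !indicE; congr (_%:R); apply/idP/idP; rewrite !inE.
    - by move=> B C; rewrite indicI.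
    - by rewrite indicT.
  rewrite integral_indic//; last first.
    by elim/big_ind : _ => // B C mB mC; exact: measurableI.
  rewrite setIT; etransitivity; first exact: indepA.
  apply: eq_bigr => i _.
  rewrite (eq_integral (fun w => (\1_(X i @^-1` A i) w)%:E)).
    by rewrite integral_indic// setIT.
  by move=> w _; rewrite gA !indicE; congr (_%:R%:E); apply/idP/idP; rewrite !inE.
have [kn|nk] := ltnP k n; last first.
  by apply: IH => // i ki; move: (ltn_ord i); rewrite ltnNge (leq_trans nk ki).
pose j := Ordinal kn.
(* With the factor at [j] replaced by an indicator, the induction hypothesis applies; the other
   factors then play the role of [Y], and the product of their integrals that of [c]. *)
pose upd A := fun i => if i == j then (\1_A : R -> R) else g i.
rewrite (bigD1 j)//=.
under eq_integral => w _ do rewrite (bigD1 j)//= mulrC.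
rewrite [RHS]muleC.
apply: integral_mul_comp_cst => //.
- under eq_fun do rewrite -big_filter.
  by apply: measurable_prod => i _; exact: measurableT_comp.
- by move=> w; exact: prodr_ge0.
- by apply: prode_ge0 => i _; apply: integral_ge0 => w _; rewrite lee_fin.
move=> A mA.
have updj i : i != j -> upd A i = g i by rewrite /upd => /negbTE ->.
have := IH (upd A).
rewrite (bigD1 j)//= [upd A j]/upd eqxx.
rewrite (eq_bigr (fun i => \int[P]_w (g i (X i w))%:E)); last first.
  by move=> i ij; rewrite updj.
rewrite [RHS]muleC => <-.
- apply: eq_integral => w _; rewrite [in RHS](bigD1 j)//= [upd A j]/upd eqxx.
  by rewrite mulrC; congr (_ * _)%:E; apply: eq_bigr => i ij; rewrite updj.
- move=> i; rewrite /upd; case: ifP => // _.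
- move=> i x; rewrite /upd; case: ifP => // _.
- move=> i ki; rewrite /upd; case: eqP => [_|/eqP ij]; first by exists A.
  by apply: g1; rewrite ltn_neqAle ki andbT; apply: contra_neq ij => ki'; exact: val_inj.
Qed.

End independence.

(** * Chernoff's bound for the mean, from a pointwise bound on the exponential *)

Section tail_bound.
Local Open Scope ereal_scope.
Variables (d : measure_display) (T : measurableType d) (R : realType).
Variable P : probability T R.

Lemma ae_bounded_integrable (f : T -> R) (C : R) :
  measurable_fun setT f -> {ae P, forall w, (`|f w| <= C)%R} ->
  P.-integrable setT (EFin \o f).
Proof.
move=> mf fC; apply/integrableP; split; first exact/measurable_EFinP.
have mnf : measurable_fun setT (Num.norm \o f) by exact: measurableT_comp.
apply: (@le_lt_trans _ _ (`|C|%:E)); last exact: ltry.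
rewrite -(@expectation_cst _ _ _ P) (_ : \int[P]_w `|(EFin \o f) w| = 'E_P[Num.norm \o f]); last first.
  by rewrite unlock.
apply: expectation_le => //=.
by apply: filterS fC => w /le_trans; apply; exact: ler_norm.
Qed.

(** Integrating the pointwise bound removes the linear term, and 1 + s <= exp(s) puts the moments in
    the exponent. Almost sure boundedness makes both moments finite, so they are returned as
    reals. *)
Lemma mgf_le (X : {RV P >-> R}) (q K l a b : R) :
  (0 <= K)%R -> (0 <= l)%R -> (0 <= q)%R -> (0 <= a)%R -> (0 <= b)%R ->
  'E_P[X] = 0 -> {ae P, forall w, (`|X w| <= K)%R} ->
  (forall x : R, `|x| <= K ->
     expR (l * x) <= 1 + l * x + a * x ^+ 2 + b * `|x| `^ q)%R ->
  exists v u : R, [/\ 'V_P[X] = v%:E, 'E_P[fun w => (`|X w| `^ q)%R] = u%:E &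
    \int[P]_w (expR (l * X w))%:E <= (expR (a * v + b * u))%:E].
Proof.
move=> K0 l0 q0 a0 b0 EX XK le_exp.
have mX : measurable_fun setT (X : T -> R) by exact: measurable_funP.
have mlX : measurable_fun setT (fun w => l * X w)%R by exact: measurable_funM.
have mX2 : measurable_fun setT (fun w => (X w) ^+ 2)%R by exact: measurable_funX.
have mXq : measurable_fun setT (fun w => `|X w| `^ q)%R.
  apply: (measurableT_comp (f := fun x : R => x `^ q)%R).
    exact: measurable_powR.
  exact: measurableT_comp.
have meX : measurable_fun setT (fun w => expR (l * X w))%R by exact: measurableT_comp.
have iX : P.-integrable setT (EFin \o X) by exact: ae_bounded_integrable XK.
have iX2 : P.-integrable setT (EFin \o (fun w => (X w) ^+ 2)%R).
  apply: (@ae_bounded_integrable _ (K ^+ 2)) => //.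
  by apply: filterS XK => w XwK; rewrite normrX lerXn2r ?nnegrE.
have iXq : P.-integrable setT (EFin \o (fun w => `|X w| `^ q)%R).
  apply: (@ae_bounded_integrable _ (K `^ q)) => //.
  by apply: filterS XK => w XwK; rewrite ger0_norm ?powR_ge0// ge0_ler_powR ?nnegrE.
have ieX : P.-integrable setT (EFin \o (fun w => expR (l * X w))%R).
  apply: (@ae_bounded_integrable _ (expR (l * K))%R) => //.
  apply: filterS XK => w XwK; rewrite ger0_norm ?expR_ge0// ler_expR ler_wpM2l//.
  by rewrite (le_trans (ler_norm _)).
have ilX : P.-integrable setT (EFin \o (fun w => l * X w)%R).
  exact: (@integrableZl _ _ _ P setT measurableT l (EFin \o X)).
pose v := fine (\int[P]_w ((X w) ^+ 2)%:E); pose u := fine (\int[P]_w (`|X w| `^ q)%:E).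
have vE : \int[P]_w ((X w) ^+ 2)%:E = v%:E.
  by rewrite fineK//; exact: integrable_fin_num iX2.
have uE : \int[P]_w (`|X w| `^ q)%:E = u%:E.
  by rewrite fineK//; exact: integrable_fin_num iXq.
exists v, u; split.
- rewrite -vE /variance unlock /= EX/=.
  rewrite unlock; apply: eq_integral => w _ /=.
  by rewrite /GRing.mul/= subr0 expr2.
- by rewrite unlock.
have El : \int[P]_w (l * X w)%:E = 0.
  under eq_integral do rewrite EFinM.
  by rewrite integralZl//; move: EX; rewrite unlock => ->; rewrite mule0.
(* [expR u - u >= 1], so subtracting the centred term [l * X] leaves a
   nonnegative integrand. *)
have -> : \int[P]_w (expR (l * X w))%:E = \int[P]_w (expR (l * X w) - l * X w)%:E.
  by rewrite integralB_EFin// El sube0.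
apply: (@le_trans _ _ (\int[P]_w (1 + a * X w ^+ 2 + b * `|X w| `^ q)%:E)).
  apply: ae_ge0_le_integral => //.
  - by move=> w _; rewrite lee_fin subr_ge0; have := @expR_ge1Dx R (l * X w); lra.
  - by apply/measurable_EFinP; exact: measurable_funB.
  - by move=> w _; rewrite lee_fin !addr_ge0// mulr_ge0// ?sqr_ge0 ?powR_ge0.
  - apply/measurable_EFinP; apply: measurable_funD; first apply: measurable_funD => //.
      exact: measurable_funM.
    exact: measurable_funM.
  - by apply: filterS XK => w /le_exp + _; rewrite lee_fin; lra.
have -> : \int[P]_w (1 + a * X w ^+ 2 + b * `|X w| `^ q)%:E = (1 + (a * v + b * u))%:E.
  rewrite (eq_integral (fun w => 1 + a%:E * (X w ^+ 2)%:E + b%:E * (`|X w| `^ q)%:E))//.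
  rewrite ge0_integralD//; last 4 first.
  - by move=> w _; rewrite -EFinM -EFinD lee_fin addr_ge0// mulr_ge0// sqr_ge0.
  - apply: emeasurable_funD => //; apply: measurable_funeM; exact/measurable_EFinP.
  - by move=> w _; rewrite -EFinM lee_fin mulr_ge0// powR_ge0.
  - by apply: measurable_funeM; exact/measurable_EFinP.
  rewrite ge0_integralD//; last 2 first.
  - by move=> w _; rewrite -EFinM lee_fin mulr_ge0// sqr_ge0.
  - by apply: measurable_funeM; exact/measurable_EFinP.
  rewrite integral_cst//= probability_setT mule1.
  rewrite !ge0_integralZl_EFin//; last 3 first.
  - exact/measurable_EFinP.
  - by move=> w _; rewrite lee_fin sqr_ge0.
  - exact/measurable_EFinP.
  by rewrite vE uE -!EFinM -!EFinD addrA.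
by rewrite lee_fin expR_ge1Dx.
Qed.

(** By independence the exponents of [mgf_le] add up to at most n(aV + bU). The last assumption is
    n(aV + bU) - l n t <= -L divided by [n]. *)
Lemma chernoff_mean (n : nat) (X : 'I_n -> {RV P >-> R}) (q K V U l a b t L : R) :
  (0 < n)%N -> (0 <= K)%R -> (0 < l)%R -> (0 <= q)%R -> (0 <= a)%R -> (0 <= b)%R ->
  mutually_independent_RV P (fun i => (X i : T -> R)) ->
  (forall i, 'E_P[X i] = 0) ->
  (n%:R)^-1%:E * \sum_(i < n) 'V_P[X i] <= V%:E ->
  (n%:R)^-1%:E * \sum_(i < n) 'E_P[fun w => (`|X i w| `^ q)%R] <= U%:E ->
  {ae P, forall w, forall i, (`|X i w| <= K)%R} ->
  (forall x : R, `|x| <= K ->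
     expR (l * x) <= 1 + l * x + a * x ^+ 2 + b * `|x| `^ q)%R ->
  (a * V + b * U + L / n%:R <= l * t)%R ->
  (1 - expR (- L))%:E <= P [set w | (n%:R^-1 * \sum_(i < n) X i w < t)%R].
Proof.
move=> n0 K0 l0 q0 a0 b0 indep EX VX UX XK le_exp le_t.
have n0R : (0 < n%:R :> R)%R by rewrite ltr0n.
have XiK i : {ae P, forall w, (`|X i w| <= K)%R} by apply: filterS XK => w.
have /choice[vu vuP] : forall i, exists vu : R * R,
    [/\ 'V_P[X i] = vu.1%:E, 'E_P[fun w => (`|X i w| `^ q)%R] = vu.2%:E &
    \int[P]_w (expR (l * X i w))%:E <= (expR (a * vu.1 + b * vu.2))%:E].
  move=> i; have [v [u vuP]] := @mgf_le (X i) q K l a b K0 (ltW l0) q0 a0 b0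
    (EX i) (XiK i) le_exp.
  by exists (v, u).
have {}VX : (n%:R^-1 * \sum_(i < n) (vu i).1 <= V)%R.
  rewrite -lee_fin EFinM -sumEFin (eq_bigr (fun i => 'V_P[X i]))// => i _.
  by have [->] := vuP i.
have {}UX : (n%:R^-1 * \sum_(i < n) (vu i).2 <= U)%R.
  rewrite -lee_fin EFinM -sumEFin.
  rewrite (eq_bigr (fun i => 'E_P[fun w => (`|X i w| `^ q)%R]))// => i _.
  by have [_ ->] := vuP i.
have mX i : measurable_fun setT (X i : T -> R) by exact: measurable_funP.
pose S w := (\sum_(i < n) X i w)%R.
have mS : measurable_fun setT S by exact: measurable_sum.
have mgfS : \int[P]_w (expR (l * S w))%:E <= (expR (n%:R * (a * V + b * U)))%:E.
  under eq_integral => w _ do rewrite mulr_sumr expR_sum.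
  have -> := @expectation_prod_indep _ _ _ P n (fun i => X i : T -> R)
    (fun _ x => expR (l * x)) mX indep; last 2 first.
  - by move=> i; apply: measurableT_comp => //; exact: measurable_funM.
  - by move=> i x; exact: expR_ge0.
  apply: (@le_trans _ _ (\prod_(i < n) (expR (a * (vu i).1 + b * (vu i).2))%:E)).
    have I_ge0 i : 0 <= \int[P]_w (expR (l * X i w))%:E.
      by apply: integral_ge0 => w _; rewrite lee_fin expR_ge0.
    (* Multiplying inequalities in the extended reals requires nonnegative factors, so the sign is
       carried along in the induction. *)
    suff [] : 0 <= \prod_(i < n) \int[P]_w (expR (l * X i w))%:E /\
      \prod_(i < n) \int[P]_w (expR (l * X i w))%:E <=
      \prod_(i < n) (expR (a * (vu i).1 + b * (vu i).2))%:E by [].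
    elim/big_ind2 : _ => [//|x1 x2 y1 y2 [x10 x12] [y10 y12]|i _].
      by rewrite mule_ge0// lee_pmul.
    by split=> //; have [] := vuP i.
  rewrite prodEFin -expR_sum lee_fin ler_expR big_split/= -!mulr_sumr.
  move: VX UX; rewrite ![(n%:R^-1 * _)%R]mulrC !ler_pdivrMr// => VX UX.
  have := ler_wpM2l a0 VX; have := ler_wpM2l b0 UX.
  lra.
have mSt : measurable [set w | (n%:R * t <= S w)%R].
  have -> : [set w | (n%:R * t <= S w)%R] = S @^-1` `[(n%:R * t)%R, +oo[%classic.
    by apply/seteqP; split=> w /=; rewrite in_itv/= andbT.
  by rewrite -[X in measurable X]setTI; exact: mS.
pose SRV : {RV P >-> R} := HB.pack S (isMeasurableFun.Build _ _ _ _ S mS).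
have tail : P [set w | (n%:R * t <= S w)%R] <= (expR (- L))%:E.
  apply: le_trans (@chernoff _ _ _ P SRV l (n%:R * t)%R l0) _.
  rewrite /mmt_gen_fun unlock.
  rewrite (eq_integral (fun w => (expR (l * S w))%:E)); last first.
    by move=> w _ /=; rewrite mulrC.
  apply: (@le_trans _ _ ((expR (n%:R * (a * V + b * U)))%:E * (expR (- (l * (n%:R * t))))%:E)).
    by rewrite lee_wpmul2r// lee_fin expR_ge0.
  rewrite -EFinM -expRD lee_fin ler_expR.
  have nL : (n%:R * (L / n%:R) = L)%R by rewrite mulrC divfK// gt_eqF.
  have := ler_wpM2l (ltW n0R) le_t; rewrite !mulrDr nL; lra.
(* The strict event is the complement of the closed tail event that Chernoff's bound controls. *)
have -> : [set w | (n%:R^-1 * \sum_(i < n) X i w < t)%R] = ~` [set w | (n%:R * t <= S w)%R].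
  apply/seteqP; split=> w /=; rewrite ltr_pdivrMl//.
    by rewrite ltNge => /negP.
  by move=> /negP; rewrite -ltNge.
by rewrite probability_setC// EFinB leeB.
Qed.

End tail_bound.

(** * Pointwise bounds on the exponential by the second and the q-th power *)

Lemma powR_div (R : realType) (x y p : R) : 0 <= x -> 0 <= y ->
  (x / y) `^ p = x `^ p / y `^ p.
Proof.
move=> x0 y0; rewrite powRM ?invr_ge0//; congr (_ * _).
by rewrite -(powR_inv1 y0) powRAC powR_inv1 ?powR_ge0.
Qed.

(** Scaling by |x|/K with exponent 2 pulls the factor x^2/K^2 out of the tail. This variance-only
    bound serves the case [K <= rho]. *)
Lemma expR_le_sqr (R : realType) (K l x : R) :
  0 < K -> 0 <= l -> `|x| <= K ->
  expR (l * x) <= 1 + l * x + expR_tail 2 (l * K) / K ^+ 2 * x ^+ 2.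
Proof.
move=> K0 l0 xK; apply: le_trans (@expR_le_tail2 R _) _; rewrite lerD2l.
have -> : `|l * x| = `|x| / K * (l * K).
  by rewrite normrM ger0_norm// mulrCA divfK ?gt_eqF.
have s01 : 0 <= `|x| / K <= 1 by rewrite divr_ge0 ?(ltW K0)//= ler_pdivrMr// mul1r.
apply: le_trans (@expR_tail_scale R 2 2 _ _ s01 _ _ _) _ => //.
  by rewrite mulr_ge0// ltW.
rewrite powR_mulrn; last by case/andP: s01.
rewrite expr_div_n real_normK ?num_real//.
by rewrite [leRHS]mulrAC -mulrA [leRHS]mulrC.
Qed.

(** Degrees below [m] are at most [q] and are interpolated; from [m] on, [|x| <= K] gives the factor
    (|x|/K)^q. At the moments rho^2 and rho^q the interpolation weights add up to 1, which leaves
    the truncated series at l rho. *)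
Lemma expR_le_moments (R : realType) (m : nat) (q K rho l : R) :
  2 < q -> m%:R <= q + 1 -> q <= m%:R -> 0 < rho -> 0 < K -> 0 <= l ->
  exists a b : R, [/\ 0 <= a, 0 <= b,
    forall x, `|x| <= K ->
      expR (l * x) <= 1 + l * x + a * x ^+ 2 + b * `|x| `^ q &
    a * rho ^+ 2 + b * rho `^ q =
    \sum_(2 <= k < m) (l * rho) ^+ k / k`!%:R +
    (rho / K) `^ q * expR_tail m (l * K)].
Proof.
move=> q2 mq qm rho0 K0 l0.
have m2 : (2 <= m)%N by rewrite -(ler_nat R) (le_trans (ltW q2)).
pose th k : R := (k%:R - 2) / (q - 2).
pose c k : R := (l * rho) ^+ k / k`!%:R.
have c0 k : 0 <= c k by rewrite divr_ge0// exprn_ge0// mulr_ge0// ltW.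
have kq k : (2 <= k < m)%N -> k%:R <= q.
  move=> /andP[_ km]; have : k.+1%:R <= m%:R :> R by rewrite ler_nat.
  by rewrite -addn1 natrD; lra.
have th01 k : (2 <= k < m)%N -> 0 <= th k <= 1.
  move=> k2m; have /andP[k2 _] := k2m.
  have q20 : 0 < q - 2 by lra.
  rewrite divr_ge0 ?subr_ge0 ?ler_nat ?(ltW q2)//= ler_pdivrMr// mul1r.
  by rewrite lerB// kq.
have K0' := ltW K0.
have E0 : 0 <= expR_tail m (l * K) by rewrite expR_tail_ge0// mulr_ge0.
(* Each degree [k] splits its coefficient with weights 1 - th and th between s^2 and s^q, where s =
   |x|/rho; the denominators undo this normalisation. *)
exists ((\sum_(2 <= k < m) c k * (1 - th k)) / rho ^+ 2).
exists ((\sum_(2 <= k < m) c k * th k) / rho `^ q + expR_tail m (l * K) / K `^ q).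
split.
- rewrite divr_ge0 ?sqr_ge0// big_nat sumr_ge0// => k /th01 /andP[_ t1].
  by rewrite mulr_ge0// subr_ge0.
- rewrite addr_ge0// divr_ge0 ?powR_ge0// big_nat sumr_ge0// => k /th01 /andP[t0 _].
  by rewrite mulr_ge0.
- move=> x xK; apply: le_trans (@expR_le_tail2 R _) _.
  rewrite -[leRHS]addrA lerD2l normrM (ger0_norm l0) (@expR_tailE R _ _ _ m2).
  have tail_le : expR_tail m (l * `|x|) <= expR_tail m (l * K) / K `^ q * `|x| `^ q.
    have -> : l * `|x| = `|x| / K * (l * K) by rewrite mulrCA divfK ?gt_eqF.
    have s01 : 0 <= `|x| / K <= 1 by rewrite divr_ge0//= ler_pdivrMr// mul1r.
    apply: le_trans (@expR_tail_scale R m q _ _ s01 _ qm _) _.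
    + by lra.
    + by rewrite mulr_ge0.
    rewrite powR_div// le_eqVlt; apply/orP; left; apply/eqP; ring.
  have sum_le : \sum_(2 <= k < m) (l * `|x|) ^+ k / k`!%:R <=
      (\sum_(2 <= k < m) c k * (1 - th k)) / rho ^+ 2 * x ^+ 2 +
      (\sum_(2 <= k < m) c k * th k) / rho `^ q * `|x| `^ q.
    set s := `|x| / rho.
    have s0 : 0 <= s by rewrite divr_ge0// ltW.
    have x2 : x ^+ 2 / rho ^+ 2 = s ^+ 2.
      by rewrite /s expr_div_n real_normK ?num_real.
    have xq : `|x| `^ q / rho `^ q = s `^ q.
      by rewrite /s powR_div// ltW.
    have -> : forall A B : R, A / rho ^+ 2 * x ^+ 2 + B / rho `^ q * `|x| `^ q =
        A * s ^+ 2 + B * s `^ q by move=> A B; rewrite -x2 -xq; ring.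
    rewrite !mulr_suml -big_split/=; apply: ler_sum_nat => k k2m.
    have /andP[k2 _] := k2m.
    have -> : (l * `|x|) ^+ k / k`!%:R = c k * s ^+ k.
      rewrite mulrAC -exprMn; congr (_ ^+ _ / _).
      by rewrite -mulrA; congr (_ * _); rewrite mulrC divfK ?gt_eqF.
    have -> : c k * (1 - th k) * s ^+ 2 + c k * th k * s `^ q =
        c k * ((1 - th k) * s ^+ 2 + th k * s `^ q) by ring.
    by rewrite ler_wpM2l// exprn_interp// kq.
  by lra.
- have rho2 : rho ^+ 2 != 0 by rewrite expf_neq0// gt_eqF.
  have rhoq : rho `^ q != 0 by rewrite gt_eqF// powR_gt0.
  rewrite divfK// mulrDl divfK// addrA -big_split/=; congr (_ + _).
    by apply: eq_bigr => k _; rewrite -mulrDr subrK mulr1.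
  by rewrite powR_div ?(ltW rho0)//; ring.
Qed.

(** * The Lambert function and the inverse of Psi *)

(** Induction with (1 + 1/m)^m <= e. This is the source of the constant 10 in the theorem. *)
Lemma expnn_le_fact (R : realType) (m : nat) :
  m%:R ^+ m <= 10 ^+ m * m`!%:R :> R.
Proof.
have e10 : expR 1 <= 10 :> R.
  (* From exp(-1/2) >= 1/2; squaring then gives e <= 4. *)
  have h : expR (1 / 2) <= 2 :> R.
    have := @expR_ge1Dx R (- (1 / 2)); rewrite expRN => h.
    have e0 := expR_gt0 (1 / 2 : R).
    by have := ler_wpM2l (ltW e0) h; rewrite mulfV ?gt_eqF//; lra.
  rewrite (_ : (1 : R) = 1 / 2 + 1 / 2); last by field.
  rewrite expRD; have e0 := expR_gt0 (1 / 2 : R); nra.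
elim: m => [|m IH]; first by rewrite fact0 !expr0 mulr1.
have [->|m0] := eqVneq m 0%N; first by rewrite factS fact0 !expr1 muln1 mulr1 ler1n.
have m0R : 0 < m%:R :> R by rewrite ltr0n lt0n.
have step : m.+1%:R ^+ m <= 10 * m%:R ^+ m :> R.
  have -> : m.+1%:R = m%:R * (1 + m%:R^-1) :> R.
    by rewrite mulrDr mulr1 divff ?gt_eqF// -addn1 natrD.
  rewrite exprMn mulrC ler_wpM2r ?exprn_ge0//; apply: le_trans e10.
  have -> : expR 1 = expR m%:R^-1 ^+ m :> R.
    by rewrite -expRM_natl mulfV ?gt_eqF.
  by rewrite lerXn2r ?nnegrE ?expR_ge0 ?expR_ge1Dx// addr_ge0 ?invr_ge0// mulr_ge0.
rewrite exprS factS natrM [10 ^+ _]exprS.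
have -> : 10 * 10 ^+ m * (m.+1%:R * m`!%:R) = m.+1%:R * (10 * (10 ^+ m * m`!%:R)) :> R by ring.
rewrite ler_wpM2l//; apply: le_trans step _.
by rewrite ler_wpM2l.
Qed.

(** Replacing [q] by the larger [m] makes the left side at most (m^m/m!) (w exp(w))^m, a power of
    the expression that the Lambert function inverts. *)
Lemma lambert_bound (R : realType) (m : nat) (q w : R) :
  0 <= q -> q <= m%:R -> 0 <= w ->
  (q * w) ^+ m / m`!%:R * expR (q * w) <= (10 * (w * expR w)) ^+ m.
Proof.
move=> q0 qm w0.
rewrite !exprMn -expRM_natl mulrA.
apply: ler_pM; rewrite ?expR_ge0//.
- by rewrite divr_ge0// mulr_ge0// exprn_ge0.
- rewrite ler_pdivrMr ?ltr0n ?fact_gt0// mulrAC ler_wpM2r ?exprn_ge0//.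
  apply: le_trans (@expnn_le_fact R m).
  by rewrite lerXn2r ?nnegrE.
- by rewrite ler_expR ler_wpM2r.
Qed.

Lemma continuous_surj_ge0 (R : realType) (f : R -> R) (y b : R) :
  continuous (f : R -> R) -> 0 <= b -> f 0 = 0 -> 0 <= y -> y <= f b ->
  exists x, 0 <= x /\ f x = y.
Proof.
move=> cf b0 f0 y0 yb.
have [|c] := @IVT R f 0 b y b0 (continuous_subspaceT cf).
  by rewrite f0 ge_min y0/= le_max yb orbT.
by rewrite in_itv/= => /andP[c0 _] <-; exists c.
Qed.

(** [get] is meaningful only on a nonempty set; a solution exists on [0, x] by the intermediate
    value theorem, as x exp(x) >= x. *)
Lemma LambertW_spec (R : realType) (x : R) : 0 <= x ->
  0 <= LambertW x /\ LambertW x * expR (LambertW x) = x.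
Proof.
move=> x0; apply: (@getPex _ [set w : R | 0 <= w /\ w * expR w = x]).
apply: (@continuous_surj_ge0 _ (fun w => w * expR w) x x) => //.
- by move=> w; apply: cvgM; [exact: cvg_id|exact: continuous_expR].
- by rewrite mul0r.
- by rewrite ler_peMr// -expR0 ler_expR.
Qed.

(** The substitution x = exp(s) - 1 removes the logarithm, so continuity is immediate; at s = 1 + y
    the value is y exp(1 + y) + 1 >= y. *)
Lemma Psi_inv_spec (R : realType) (y : R) : 0 <= y ->
  0 <= Psi_inv y /\ Psi (Psi_inv y) = y.
Proof.
move=> y0; apply: (@getPex _ [set x : R | 0 <= x /\ Psi x = y]).
have PsiE (s : R) : Psi (expR s - 1) = expR s * s - (expR s - 1).
  by rewrite /Psi (_ : 1 + (expR s - 1) = expR s) ?expRK//; ring.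
have [s [s0 sy]] : exists s : R, 0 <= s /\ Psi (expR s - 1) = y.
  apply: (@continuous_surj_ge0 _ (fun s => Psi (expR s - 1)) y (1 + y)) => //.
  - have -> : (fun s : R => Psi (expR s - 1)) = (fun s => expR s * s - (expR s - 1)).
      exact/funext.
    move=> s; apply: cvgB; first by apply: cvgM; [exact: continuous_expR|exact: cvg_id].
    by apply: cvgB; [exact: continuous_expR|exact: cvg_cst].
  - by rewrite addr_ge0.
  - by rewrite expR0 subrr /Psi addr0 ln1 mulr0 subr0.
  - rewrite PsiE.
    by have := @expR_ge1Dx R (1 + y); nra.
exists (expR s - 1); split=> //.
by rewrite subr_ge0 -expR0 ler_expR.
Qed.

(* [ln (1 + y)] is the maximiser in the Legendre dual of [Psi]. *)
Lemma bennett_dual (R : realType) (y : R) : 0 < y ->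
  expR_tail 2 (ln (1 + y)) + Psi y = ln (1 + y) * y.
Proof.
move=> y0; rewrite /expR_tail !big_nat_recr//= big_geq// !fact0 factS fact0.
rewrite expr0 expr1 !divr1 add0r lnK ?posrE; last by lra.
by rewrite /Psi; ring.
Qed.

(** * Choice of the exponent in Chernoff's bound *)

(** The case R = 0. Since the second-order tail over t^2 is nondecreasing, [K <= rho] allows [K] to
    be replaced by [rho], after which [bennett_dual] is an equality at l = ln(1 + y)/rho. *)
Lemma exponent_choice_bennett (R : realType) (K rho V x y : R) :
  0 < K -> K <= rho -> 0 < V -> 0 < y -> Psi y = rho ^+ 2 / V * x ->
  exists l a : R, [/\ 0 < l, 0 <= a,
    forall u, `|u| <= K -> expR (l * u) <= 1 + l * u + a * u ^+ 2 &
    a * V + x <= l * (V / rho * y)].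
Proof.
move=> K0 Krho V0 y0 Psiy.
have rho0 : 0 < rho by exact: lt_le_trans Krho.
set l := ln (1 + y) / rho.
have l0 : 0 < l by rewrite divr_gt0// ln_gt0; lra.
have lK0 : 0 <= l * K by rewrite mulr_ge0// ltW.
have lrho : l * rho = ln (1 + y) by rewrite divfK ?gt_eqF.
exists l, (expR_tail 2 (l * K) / K ^+ 2); split=> //.
- by rewrite divr_ge0 ?sqr_ge0// expR_tail_ge0.
- by move=> u uK; apply: expR_le_sqr => //; exact: ltW.
have s01 : 0 <= K / rho <= 1.
  by rewrite divr_ge0 ?(ltW K0) ?(ltW rho0)//= ler_pdivrMr// mul1r.
have lrho0 : 0 <= l * rho by rewrite mulr_ge0// ltW.
have tail_le : expR_tail 2 (l * K) / K ^+ 2 <= expR_tail 2 (l * rho) / rho ^+ 2.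
  have -> : l * K = K / rho * (l * rho) by field; rewrite gt_eqF.
  rewrite ler_pdivrMr ?exprn_gt0//.
  apply: le_trans (@expR_tail_scale R 2 2 _ _ s01 _ _ lrho0) _ => //.
  rewrite powR_mulrn; last by case/andP: s01.
  by rewrite le_eqVlt; apply/orP; left; apply/eqP; field; rewrite gt_eqF.
have xE : x = V / rho ^+ 2 * Psi y.
  by rewrite Psiy; field; rewrite !gt_eqF.
have -> : l * (V / rho * y) = V / rho ^+ 2 * (ln (1 + y) * y).
  by rewrite /l; field; rewrite gt_eqF.
rewrite -bennett_dual// mulrDr {1}xE lerD2r mulrC -lrho [leRHS]mulrAC -mulrA.
by rewrite ler_wpM2l// ltW.
Qed.

(** Here s^m <= s because [m >= 1], and exp(s t) <= exp(t). It expresses that F(l)/l is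
    nondecreasing. *)
Lemma expn_expR_shrink (R : realType) (m : nat) (s t : R) :
  (0 < m)%N -> 0 <= s <= 1 -> 0 <= t ->
  (s * t) ^+ m / m`!%:R * expR (s * t) <= s * (t ^+ m / m`!%:R * expR t).
Proof.
move=> m0 /andP[s0 s1] t0.
rewrite exprMn -!mulrA; apply: ler_pM.
- by rewrite exprn_ge0.
- by rewrite mulr_ge0 ?exprn_ge0// mulr_ge0 ?invr_ge0 ?expR_ge0.
- by rewrite -[leRHS]expr1 ler_wiXn2l.
- rewrite ler_wpM2l ?exprn_ge0// ler_wpM2l ?invr_ge0// ler_expR.
  by rewrite ler_piMl.
Qed.

Lemma exponent_choice (R : realType) (m : nat) (q K rho V x y w : R) :
  2 < q -> m%:R <= q + 1 -> q <= m%:R -> 0 < rho -> rho <= K -> 0 < V ->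
  0 < x -> 0 < y -> 0 < w -> Psi y = rho ^+ 2 / V * x ->
  V / rho ^+ 2 * (rho / K) `^ q * (1 - rho / K) * (10 * (w * expR w)) ^+ m <= x ->
  exists l a b : R, [/\ 0 < l, 0 <= a, 0 <= b,
    forall u, `|u| <= K ->
      expR (l * u) <= 1 + l * u + a * u ^+ 2 + b * `|u| `^ q &
    a * V + b * (V / rho ^+ 2 * rho `^ q) + x <=
    l * (V / rho * y + 2 * K * x / (q * w))].
Proof.
move=> q2 mq qm rho0 rhoK V0 x0 y0 w0 Psiy Wx.
have K0 : 0 < K by exact: lt_le_trans rhoK.
have q0 : 0 < q by lra.
have m1 : (0 < m)%N by rewrite -(ltr_nat R) (lt_le_trans q0).
set l1 := ln (1 + y) / rho; set l2 := q * w / K.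
have l10 : 0 < l1 by rewrite divr_gt0// ln_gt0; lra.
have l20 : 0 < l2 by rewrite divr_gt0// mulr_gt0.
(* The weights add up to 1, and al l1 = be l2 is the [l] with 1/l = 1/l1 + 1/l2. *)
set al := l2 / (l1 + l2); set be := l1 / (l1 + l2).
have l12 : 0 < l1 + l2 by rewrite addr_gt0.
have al0 : 0 < al by rewrite divr_gt0.
have be0 : 0 < be by rewrite divr_gt0.
have albe : al + be = 1 by rewrite /al /be; field; rewrite gt_eqF.
set l := al * l1.
have lE : l = be * l2 by rewrite /l /al /be; field; rewrite gt_eqF.
have l0 : 0 < l by rewrite mulr_gt0.
have [a [b [a0 b0 le_exp abE]]] :=
  @expR_le_moments R m q K rho l q2 mq qm rho0 K0 (ltW l0).
exists l, a, b; split=> //.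
set r := rho / K.
have r01 : 0 < r <= 1 by rewrite divr_gt0//= ler_pdivrMr// mul1r.
have lK0 : 0 <= l * K by rewrite mulr_ge0// ltW.
have rlK : r * (l * K) = l * rho by rewrite /r; field; rewrite gt_eqF.
have m2 : (2 <= m)%N by rewrite -(ler_nat R) (le_trans (ltW q2)).
set c := V / rho ^+ 2.
have c0 : 0 < c by rewrite divr_gt0// exprn_gt0.
set F := fun t : R => r `^ q * ((1 - r) * (t ^+ m / m`!%:R * expR t)).
(* [expR_tail_contract] turns r^q times the tail at l K into the tail at l rho plus F; the former
   completes the truncated series to the full Bennett function. *)
have ab_le : a * V + b * (c * rho `^ q) <= c * (expR_tail 2 (l * rho) + F (l * K)).
  have -> : a * V + b * (c * rho `^ q) = c * (a * rho ^+ 2 + b * rho `^ q).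
    by rewrite /c; field; rewrite gt_eqF.
  rewrite abE ler_wpM2l ?(ltW c0)// (@expR_tailE R m 2)// -addrA lerD2l.
  have := @expR_tail_contract R m q r (l * K) r01 m1 mq lK0.
  by rewrite rlK.
have tail_le : expR_tail 2 (l * rho) <= al * expR_tail 2 (l1 * rho).
  rewrite /l -mulrA -[X in X * expR_tail _ _](powRr1 (ltW al0)).
  apply: expR_tail_scale => //.
  - by rewrite (ltW al0)/=; lra.
  - by rewrite ler1n.
  - by rewrite mulr_ge0// ltW.
have F_le : F (l * K) <= be * F (l2 * K).
  rewrite /F.
  have -> : forall u, be * (r `^ q * ((1 - r) * u)) = r `^ q * ((1 - r) * (be * u)).
    by move=> u; ring.
  have [r0 r1] := andP r01.
  rewrite ler_wpM2l ?powR_ge0// ler_wpM2l ?subr_ge0//.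
  have -> : l * K = be * (l2 * K) by rewrite lE mulrA.
  apply: expn_expR_shrink => //.
    by rewrite (ltW be0)/=; lra.
  by rewrite mulr_ge0// ltW.
have F2 : c * F (l2 * K) <= x.
  have -> : l2 * K = q * w by rewrite /l2 divfK ?gt_eqF.
  apply: le_trans Wx; rewrite -/c -/r.
  have -> : forall u, c * (r `^ q * ((1 - r) * u)) = c * r `^ q * (1 - r) * u.
    by move=> u; ring.
  have [r0 r1] := andP r01.
  rewrite ler_wpM2l//; last by apply: lambert_bound => //; exact: ltW.
  by rewrite mulr_ge0 ?subr_ge0// mulr_ge0 ?powR_ge0// ltW.
have xE : x = c * Psi y.
  by rewrite Psiy /c; field; rewrite !gt_eqF.
have E1 : c * expR_tail 2 (l1 * rho) + x = l1 * (V / rho * y).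
  rewrite xE -mulrDr /l1 divfK ?gt_eqF// bennett_dual// /c.
  by field; rewrite gt_eqF.
(* The factor 2 of the second term pays for both F(l2), at most x, and the deviation x itself. *)
have E2 : l2 * (2 * K * x / (q * w)) = 2 * x.
  by rewrite /l2; field; rewrite !gt_eqF.
have -> : l * (V / rho * y + 2 * K * x / (q * w)) =
    al * (l1 * (V / rho * y)) + be * (l2 * (2 * K * x / (q * w))).
  by rewrite mulrDr {2}lE /l !mulrA.
rewrite -E1 E2.
have := ler_wpM2l (ltW c0) tail_le; have := ler_wpM2l (ltW c0) F_le.
have := ler_wpM2l (ltW be0) F2.
move: ab_le; rewrite mulrDr.
set A := a * V + _; set G := expR_tail _ _; set G1 := expR_tail _ _.
set F1 := F _; set F3 := F _.
have alE : al = 1 - be by lra.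
rewrite alE; lra.
Qed.

(** * The parameters of the theorem in terms of rho, and the conclusion *)

(** Here rho = (B^q/sigma^2)^(1/(q-2)). Written as exponentials of logarithms, the power identities
    become rational identities between exponents. *)
Lemma moment_scale (R : realType) (q sigma B K : R) :
  2 < q -> 0 < sigma -> 0 < B -> 0 < K ->
  exists rho : R, [/\ 0 < rho,
    B `^ q = sigma ^+ 2 / rho ^+ 2 * rho `^ q,
    B * (sigma ^+ 2 / B ^+ 2) `^ ((q - 1) / (q - 2)) = sigma ^+ 2 / rho,
    (B ^+ 2 / sigma ^+ 2) `^ (q / (q - 2)) = rho ^+ 2 / sigma ^+ 2 &
    (B `^ q / (sigma ^+ 2 * K `^ (q - 2))) `^ (1 / (q - 2)) = rho / K].
Proof.
move=> q2 s0 B0 K0.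
have q20 : q - 2 != 0 by rewrite gt_eqF//; lra.
rewrite -(lnK s0) -(lnK B0) -(lnK K0).
set s := ln sigma; set b := ln B; set k := ln K.
exists (expR ((q * b - 2 * s) / (q - 2))); rewrite expR_gt0.
have X2 (u : R) : expR u ^+ 2 = expR (2 * u) by rewrite expRM_natl.
rewrite !X2 -!expRM -!expRN -!expRD -!expRM -!expRN -!expRD -!expRM.
by split=> //; congr expR; field.
Qed.

Lemma natr_succ_floor (R : realType) (q : R) : 0 <= q ->
  exists m : nat, [/\ (Num.floor q)%:~R + 1 = m%:R :> R, q <= m%:R & m%:R <= q + 1].
Proof.
move=> q0.
have f0 : 0 <= Num.floor q by rewrite floor_ge0.
have fle := ge_floor q; have flt := floorD1_gt q.
exists (`|Num.floor q|%N.+1).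
have E : (Num.floor q)%:~R + 1 = (`|Num.floor q|%N.+1)%:R :> R.
  by rewrite -[in LHS](gez0_abs f0) -addn1 natrD.
by rewrite -E; split=> //; rewrite ?lerD2r// ltW// -intrD1.
Qed.

Theorem theorem4p2 (d : measure_display) (T : measurableType d) (R : realType)
  (P : probability T R) (n : nat) (X : 'I_n -> {RV P >-> R})
  (q sigma B K : R) :
  (0 < n)%N -> 2 < q -> 0 < sigma -> 0 < B -> 0 < K ->
  mutually_independent_RV P (fun i => (X i : T -> R)) ->
  (forall i, ('E_P[X i])%E = 0%E) ->
  ((n%:R)^-1%:E * \sum_(i < n) 'V_P[X i] <= (sigma ^+ 2)%:E)%E ->
  ((n%:R)^-1%:E * \sum_(i < n) 'E_P[fun w => (`|X i w| `^ q)%R] <= (B `^ q)%:E)%E ->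
  {ae P, forall w, forall i, `|X i w| <= K} ->
  let Rr := Num.max 0 (1 - (B `^ q / (sigma ^+ 2 * K `^ (q - 2))) `^ (1 / (q - 2))) in
  let fq : R := (Num.floor q)%:~R + 1 in
  forall z : R, 1 < z ->
  ((1 - z^-1)%:E <=
   P [set w | (n%:R^-1 * \sum_(i < n) X i w <
     B * (sigma ^+ 2 / B ^+ 2) `^ ((q - 1) / (q - 2)) *
       Psi_inv ((B ^+ 2 / sigma ^+ 2) `^ (q / (q - 2)) * (ln z / n%:R))
     + (if Rr == 0 then 0 else
        (2 * K * ln z / (n%:R * q)) *
        (LambertW ((K / B) `^ (q / fq) * (ln z) `^ (1 / fq)
                   / (10 * (n%:R * Rr) `^ (1 / fq))))^-1))%R])%E.
Proof.
move=> n0 q2 s0 B0 K0 indep EX VX UX XK Rr fq z z1.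
have q0 : 0 < q by lra.
have [m [fqE qm mq]] := @natr_succ_floor R q (ltW q0).
have [rho [rho0 UE t1E rho2E rE]] := @moment_scale R q sigma B K q2 s0 B0 K0.
have n0R : 0 < n%:R :> R by rewrite ltr0n.
have L0 : 0 < ln z by rewrite ln_gt0.
have x0 : 0 < ln z / n%:R by rewrite divr_gt0.
have V0 : 0 < sigma ^+ 2 by rewrite exprn_gt0.
have -> : z^-1 = expR (- ln z) by rewrite expRN lnK// posrE; lra.
have RrE : Rr = Num.max 0 (1 - rho / K) by rewrite /Rr rE.
rewrite t1E rho2E {}RrE {Rr}.
have arg0 : 0 < rho ^+ 2 / sigma ^+ 2 * (ln z / n%:R).
  by rewrite mulr_gt0// divr_gt0// exprn_gt0.
have [] := @Psi_inv_spec R _ (ltW arg0).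
set y := Psi_inv _ => y0 Psiy.
have {}y0 : 0 < y.
  rewrite lt_neqAle y0 andbT; apply/eqP => y_eq0.
  by move: arg0; rewrite -Psiy -y_eq0 /Psi addr0 ln1 mulr0 subr0 ltxx.
(* If [K <= rho] then R = 0, the second term is 0 by convention, and the q-th moment receives the
   coefficient [b = 0]. *)
have [Krho|rhoK] := leP K rho.
  have -> : Num.max 0 (1 - rho / K) = 0.
    by apply/max_idPl; rewrite subr_le0 ler_pdivlMr// mul1r.
  rewrite eqxx addr0.
  have [l [a [l0 a0 le_exp le_t]]] :=
    @exponent_choice_bennett R K rho _ _ y K0 Krho V0 y0 Psiy.
  apply: (@chernoff_mean _ _ _ P n X q K _ _ l a 0 _ (ln z)
    n0 (ltW K0) l0 (ltW q0) a0 (lexx 0) indep EX VX UX XK).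
    by move=> x /le_exp; rewrite mul0r addr0.
  by rewrite mul0r addr0.
have r1 : 0 < 1 - rho / K by rewrite subr_gt0 ltr_pdivrMr// mul1r.
have -> : Num.max 0 (1 - rho / K) = 1 - rho / K by apply/max_idPr; exact: ltW.
rewrite gt_eqF// /fq fqE.
have m0 : (0 < m)%N by rewrite -(ltr_nat R) (lt_le_trans q0).
have m0R : m%:R != 0 :> R by rewrite pnatr_eq0 -lt0n.
set A := _ / (10 * _).
have A0 : 0 < A by rewrite divr_gt0// mulr_gt0// powR_gt0// ?divr_gt0// mulr_gt0.
have [] := @LambertW_spec R _ (ltW A0).
set w := LambertW _ => w0 wE.
have {}w0 : 0 < w.
  by rewrite lt_neqAle w0 andbT; apply/eqP => w_eq0; rewrite -wE -w_eq0 mul0r ltxx in A0.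
have powm (u p : R) : 0 <= u -> (u `^ (p / m%:R)) ^+ m = u `^ p.
  by move=> u0; rewrite -powR_mulrn ?powR_ge0// -powRrM divfK.
(* The m-th power clears the exponents 1/([q]+1). Since B^q = sigma^2 rho^(q-2), this value makes
   the condition on [w] in [exponent_choice] an equality. *)
have AE : (10 * A) ^+ m = (K / B) `^ q * (ln z / n%:R) / (1 - rho / K).
  have -> : 10 * A = (K / B) `^ (q / m%:R) * ln z `^ (1 / m%:R) /
      (n%:R * (1 - rho / K)) `^ (1 / m%:R).
    by rewrite /A; field; rewrite gt_eqF// powR_gt0// mulr_gt0.
  rewrite expr_div_n exprMn !powm ?powRr1 ?(ltW L0)//.
  - by rewrite invfM !mulrA.
  - by rewrite mulr_ge0// ltW.
  - by rewrite mulr_ge0// ltW.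
  - by rewrite divr_ge0// ltW.
have [] := @exponent_choice R m q K rho _ _ y w q2 mq qm rho0 (ltW rhoK) V0 x0 y0 w0 Psiy.
  rewrite wE AE !powR_div ?(ltW K0) ?(ltW rho0) ?(ltW B0)// UE.
  move: (1 - rho / K) r1 => r r1.
  rewrite le_eqVlt; apply/orP; left; apply/eqP; field.
  by rewrite !gt_eqF ?powR_gt0.
move=> l [a [b [l0 a0 b0 le_exp le_t]]].
apply: (@chernoff_mean _ _ _ P n X q K _ _ l a b _ (ln z)
    n0 (ltW K0) l0 (ltW q0) a0 b0 indep EX VX UX XK le_exp).
rewrite UE (_ : 2 * K * ln z / (n%:R * q) / w = 2 * K * (ln z / n%:R) / (q * w))//.
by field; rewrite !gt_eqF.
Qed.
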